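(* Let $G$ be a graph, let $(f_{1}, f_{2}, \dots, f_{s})$ be a sequence of nonnegative integer valued functions on $V(G)$, and let $(H, f)$ be the valued ID-cover of $G$ given by $f(v, i) = f_{i}(v)$ for each $v \in V(G)$ and each $i \in \{1, \dots, s\}$. Then $H$ has a strictly $f$-degenerate transversal if and only if $G$ is $(f_{1}, f_{2}, \dots, f_{s})$-partitionable.
   Context: All graphs are simple, finite and undirected; $s$ is a positive integer. The ID-cover of a graph $G$ is the graph $H$ with vertex set $\bigcup_{v \in V(G)} X_v$, $X_v = \{(v,1), \dots, (v,s)\}$, in which $(u,p)$ and $(v,q)$ are adjacent if and only if $uv \in E(G)$ and $p = q$; a valued ID-cover is a pair $(H,f)$ with $H$ the ID-cover and $f$ a function from $V(H)$ to the nonnegative integers. A set $R \subseteq V(H)$ is a transversal of $H$ if $|R \cap X_v| = 1$ for each $v \in V(G)$. A graph with a nonnegative integer valued function $f$ on its vertices is strictly $f$-degenerate if every nonempty subgraph $\Gamma$ of it has a vertex $x$ with $\deg_\Gamma(x) < f(x)$. A transversal $R$ is a strictly $f$-degenerate transversal if $H[R]$ is strictly $f$-degenerate. $G$ is $(f_1, \dots, f_s)$-partitionable if $V(G)$ has a partition $(V_1, \dots, V_s)$ (parts may be empty) such that $G[V_i]$ is strictly $f_i$-degenerate for each $i \in \{1,\dots,s\}$. *)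

(* Defs.v *)
From mathcomp Require Import all_boot.
Set Implicit Arguments.
Unset Strict Implicit.
Unset Printing Implicit Defensive.

Record sgraph := SGraph {
  vertex :> finType;
  adj : rel vertex;
  adj_sym : symmetric adj;
  adj_irr : irreflexive adj
}.

(* Subgraphs are arbitrary, not necessarily induced. *)
Record subgraph (G : sgraph) := Subgraph {
  sub_vert : {set G};
  sub_adj : rel G;
  sub_adj_sym : symmetric sub_adj;
  sub_adjW : forall x y, sub_adj x y -> adj x y;
  sub_adj_vert : forall x y, sub_adj x y -> (x \in sub_vert) && (y \in sub_vert)
}.

Definition sub_deg (G : sgraph) (K : subgraph G) (x : G) : nat :=
  #|[set y | sub_adj K x y]|.

Definition strictly_degenerate (G : sgraph) (f : G -> nat) : Prop :=
  forall K : subgraph G, sub_vert K != set0 ->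
  exists2 x : G, x \in sub_vert K & sub_deg K x < f x.

Section Induced.
Variables (G : sgraph) (A : {set G}).

Definition induced_adj : rel {x : G | x \in A} :=
  fun x y => adj (val x) (val y).

Lemma induced_adj_sym : symmetric induced_adj.
Proof. by move=> x y; apply: adj_sym. Qed.

Lemma induced_adj_irr : irreflexive induced_adj.
Proof. by move=> x; apply: adj_irr. Qed.

Definition induced : sgraph := SGraph induced_adj_sym induced_adj_irr.

Definition restrict (f : G -> nat) : induced -> nat := fun x => f (val x).

End Induced.

(* The labels 1, ..., s are represented by 'I_s, i.e., shifted to 0, ..., s-1. *)
Section IDCover.
Variables (G : sgraph) (s : nat).

Definition idcover_adj : rel (G * 'I_s)%type :=
  fun x y => adj x.1 y.1 && (x.2 == y.2).

Lemma idcover_adj_sym : symmetric idcover_adj.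
Proof. by move=> x y; rewrite /idcover_adj adj_sym eq_sym. Qed.

Lemma idcover_adj_irr : irreflexive idcover_adj.
Proof. by move=> x; rewrite /idcover_adj adj_irr. Qed.

Definition idcover : sgraph := SGraph idcover_adj_sym idcover_adj_irr.

Definition fiber (v : G) : {set idcover} := [set (v, i) | i : 'I_s].

Definition transversal (R : {set idcover}) : Prop :=
  forall v : G, #|R :&: fiber v| = 1.

Definition strictly_degenerate_transversal
    (f : idcover -> nat) (R : {set idcover}) : Prop :=
  transversal R /\ strictly_degenerate (@restrict idcover R f).

(* finset.partition is not used: it forbids empty parts and forgets labels. *)
Definition partitionable (fs : 'I_s -> G -> nat) : Prop :=
  exists V : 'I_s -> {set G},
    [/\ forall i j, i != j -> [disjoint V i & V j],
        \bigcup_(i < s) V i = [set: G]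
      & forall i, strictly_degenerate (@restrict G (V i) (fs i))].

End IDCover.

(* Main.v *)
(** Vertices of the ID-cover with different labels are never adjacent, so the
    neighbours of [(x, i)] inside a set [S] of cover vertices correspond to the
    neighbours of [x] inside the [i]-th slice of [S].  A transversal is the same
    thing as the labelled partition formed by its slices, and a vertex of small
    degree in one nonempty slice of [S] is a vertex of small degree in [S]. *)
Require Import Defs.
From mathcomp Require Import all_boot.

Definition deg_in {G : sgraph} (S : {set G}) (x : G) : nat :=
  #|[set y in S | adj x y]|.

Section InducedSubgraph.
Variables (G : sgraph) (S : {set G}).

Let e : rel G := fun x y => [&& x \in S, y \in S & adj x y].

Lemma spanned_sym : symmetric e.
Proof. by move=> x y; rewrite /e adj_sym andbCA. Qed.

Lemma spannedW x y : e x y -> adj x y.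
Proof. by case/and3P. Qed.

Lemma spanned_vert x y : e x y -> (x \in S) && (y \in S).
Proof. by case/and3P=> -> ->. Qed.

Definition spanned : subgraph G :=
  @Subgraph G S e spanned_sym spannedW spanned_vert.

Lemma sub_deg_spanned x : x \in S -> sub_deg spanned x = deg_in S x.
Proof. by move=> xS; apply: eq_card => y; rewrite !inE /= /e xS. Qed.

End InducedSubgraph.

Lemma sub_deg_le (G : sgraph) (K : subgraph G) (x : G) :
  sub_deg K x <= deg_in (sub_vert K) x.
Proof.
apply/subset_leq_card/subsetP=> y; rewrite !inE => Kxy.
by rewrite (sub_adjW Kxy); have /andP[_ ->] := sub_adj_vert Kxy.
Qed.

(** Among all subgraphs on a given vertex set, the induced one has the largest degrees, so it
    suffices to test induced subgraphs. *)
Lemma strictly_degenerateP (G : sgraph) (f : G -> nat) :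
  strictly_degenerate f <->
  (forall S : {set G}, S != set0 -> exists2 x, x \in S & deg_in S x < f x).
Proof.
split=> [fD S S0 | fD K K0].
  have [x xS ltx] := fD (spanned G S) S0.
  by exists x => //; rewrite -sub_deg_spanned.
have [x xK ltx] := fD _ K0.
by exists x => //; apply: leq_ltn_trans ltx; apply: sub_deg_le.
Qed.

Lemma deg_in_induced (G : sgraph) (A : {set G}) (S : {set induced A})
    (x : induced A) : deg_in (val @: S) (val x) = deg_in S x.
Proof.
rewrite /deg_in -(card_imset _ val_inj); apply: eq_card => y; rewrite !inE.
apply/andP/imsetP => [[/imsetP[z zS ->] xz] | [z + ->]].
  by exists z; rewrite // inE zS.
by rewrite inE => /andP[zS xz]; rewrite imset_f.
Qed.

(** Through [val], vertex sets of the induced graph correspond to subsets of [A], and degrees are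
    preserved. *)
Lemma strictly_degenerate_inducedP (G : sgraph) (A : {set G}) (f : G -> nat) :
  strictly_degenerate (@restrict G A f) <->
  (forall S : {set G}, S \subset A -> S != set0 ->
     exists2 x, x \in S & deg_in S x < f x).
Proof.
split=> [/strictly_degenerateP fD S /subsetP SA /set0Pn[x0 x0S] | fD].
  pose T : {set induced A} := [set x | val x \in S].
  have TS : val @: T = S.
    apply/setP=> y; apply/imsetP/idP => [[z + ->] | yS]; first by rewrite inE.
    by exists (Sub y (SA y yS)); rewrite ?inE.
  have T0 : T != set0.
    by apply/set0Pn; exists (Sub x0 (SA x0 x0S)); rewrite inE.
  have [x xT ltx] := fD T T0.
  by exists (val x); rewrite -TS ?imset_f // deg_in_induced.
apply/strictly_degenerateP=> T T0.
have [||_ /imsetP[x xT ->] ltx] := fD (val @: T).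
- by apply/subsetP=> _ /imsetP[x _ ->]; apply: valP.
- by rewrite imset_eq0.
by exists x => //; rewrite -deg_in_induced.
Qed.

Section Slices.
Context {G : sgraph} {s : nat}.
Implicit Types (R S : {set idcover G s}) (i : 'I_s).

Definition slice R i : {set G} := [set v | (v, i) \in R].

Lemma deg_in_idcover S x i :
  deg_in S (x, i) = deg_in (slice S i) x.
Proof.
have inj : injective (fun v : G => (v, i)) by move=> u v [].
rewrite /deg_in -(card_imset _ inj); apply: eq_card => -[y j].
rewrite !inE; apply/andP/imsetP => [[yS /andP[/= xy /eqP ij]] | [z + [-> ->]]].
  by subst j; exists y; rewrite // !inE yS.
by rewrite !inE => /andP[zS xz]; rewrite zS /= /idcover_adj xz eqxx.
Qed.

(** The labels [i] with [v] in [slice R i] are those of the elements of [R] over [v]: disjointness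
    says that there is at most one, covering that there is at least one. *)
Lemma transversalP R :
  Defs.transversal R <->
  (forall i j, i != j -> [disjoint slice R i & slice R j]) /\
  \bigcup_(i < s) slice R i = [set: G].
Proof.
have memF v p : (p \in fiber s v) = (p.1 == v).
  apply/imsetP/eqP => [[i _ ->] // | <-].
  by exists p.2 => //; case: p.
split=> [tR | [dR cR] v].
  split=> [i j /eqP ij | ].
    rewrite disjoint_subset; apply/subsetP=> v; rewrite !inE => vi.
    (* Both [(v, i)] and [(v, j)] would equal the single element [p] of [R] over [v], forcing
       [i = j]. *)
    apply/negP=> vj; have /eqP/cards1P[p Rv] := tR v.
    have /setP := Rv => Rv'.
    have := Rv' (v, i); have := Rv' (v, j).
    rewrite !inE !memF vi vj !eqxx => /esym/eqP<- /esym/eqP[].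
    exact: ij.
  apply/setP=> v; rewrite inE; apply/bigcupP.
  have /eqP/cards1P[p /setP/(_ p)] := tR v.
  rewrite !inE memF eqxx => /andP[pR /eqP pv].
  by exists p.2; rewrite // inE -pv; case: p pR {pv}.
have: v \in [set: G] by rewrite inE.
rewrite -cR => /bigcupP[i _ vi]; apply/eqP/cards1P; exists (v, i).
apply/setP=> -[u j]; rewrite !inE memF /= xpair_eqE andbC.
case: eqP => //= ->; apply/idP/eqP => [vj | ->]; last by rewrite inE in vi.
apply/eqP/negPn/negP=> /dR/pred0P/(_ v) /=.
by rewrite vi inE vj.
Qed.

Lemma strictly_degenerate_slicesP R (f : idcover G s -> nat) :
  strictly_degenerate (@restrict (idcover G s) R f) <->
  (forall i,
     strictly_degenerate (@restrict G (slice R i) (fun v => f (v, i)))).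
Proof.
split=> [/strictly_degenerate_inducedP fD i | fD].
  apply/strictly_degenerate_inducedP=> S /subsetP SR S0.
  (* The copy of [S] at level [i] lies in [R], and its [i]-th slice is [S] itself. *)
  have [||_ /imsetP[x xS ->]] := fD [set (v, i) | v in S].
  - by apply/subsetP=> _ /imsetP[v /SR + ->]; rewrite inE.
  - by rewrite imset_eq0.
  rewrite deg_in_idcover => ltx; exists x => //.
  suff -> : S = slice [set (v, i) | v in S] i by [].
  by apply/setP=> v; rewrite inE mem_imset // => u w [].
apply/strictly_degenerate_inducedP=> S /subsetP SR /set0Pn[[v i] vS].
(* The label [i] of an arbitrary element of [S] selects a slice that is nonempty. *)
have /strictly_degenerate_inducedP/(_ (slice S i)) [||x xS ltx] := fD i.
- by apply/subsetP=> u; rewrite !inE; apply: SR.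
- by apply/set0Pn; exists v; rewrite inE.
by exists (x, i); rewrite ?deg_in_idcover //; rewrite inE in xS.
Qed.

End Slices.

Theorem proposition1 (G : sgraph) (s : nat) (hs : 0 < s)
    (fs : 'I_s -> G -> nat) (f : idcover G s -> nat)
    (hf : forall (v : G) (i : 'I_s), f (v, i) = fs i v) :
  (exists R : {set idcover G s}, strictly_degenerate_transversal f R) <->
  partitionable fs.
Proof.
(* [hf] gives only pointwise equality, so the property is transferred vertex by vertex, without
   functional extensionality. *)
have fsE i A : strictly_degenerate (@restrict G A (fun v => f (v, i))) <->
               strictly_degenerate (@restrict G A (fs i)).
  by split=> fD K /fD[x xK ltx]; exists x => //; move: ltx; rewrite /restrict hf.
split=> [[R [/transversalP[dR cR] /strictly_degenerate_slicesP fD]] | ].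
  by exists (slice R); split=> // i; apply/fsE.
case=> V [dV cV fD]; pose R : {set idcover G s} := [set p | p.1 \in V p.2].
have RE i : slice R i = V i by apply/setP=> v; rewrite !inE.
exists R; split.
  apply/transversalP; split=> [i j ij|]; first by rewrite !RE; apply: dV.
  by rewrite -cV; apply: eq_bigr.
by apply/strictly_degenerate_slicesP=> i; rewrite RE; apply/fsE.
Qed.
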